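(* For every odd $n \in \mathbb{N}$ with $n \ge 5$, there exists an $(n,2)$-HSF $f_{n,2}$ with $\mathbf{D}[f_{n,2}] \in \left(1 + \Omega(n^{-1})\right)\mathbf{D}[f^*_{n,2}]$, i.e. there is an absolute constant $c>0$ such that $\mathbf{D}[f_{n,2}] \ge (1 + c/n)\,\mathbf{D}[f^*_{n,2}]$ for all such $n$.
   Context: A boolean function $f:\{-1,1\}^n\to\{-1,1\}$ is an $(n,d)$-PTF if there is a polynomial $p\in\mathbb{R}[x_1,\dots,x_n]$ of degree at most $d$ with $f(x)=\mathrm{sgn}(p(x))$ for all $x\in\{-1,1\}^n$. The dichromatic count $\mathbf{D}[f]$ is the number of unordered pairs $\{x,y\}$ of points of $\{-1,1\}^n$ differing in exactly one coordinate with $f(x)\ne f(y)$. Let $p^*_{n,d}$ be the monic univariate polynomial of degree $d$ with (non-repeated) roots at the $d$ integers closest to $0$ of opposite parity from $n$, and let $f^*_{n,d}(x)=\mathrm{sgn}\left(p^*_{n,d}\left(\sum_{i=1}^n x_i\right)\right)$. An $(n,d)$-HSF (hypersensitive function) is an $(n,d)$-PTF $f$ with $\mathbf{D}[f] > \mathbf{D}[f^*_{n,d}]$. *)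

(* Defs.v *)
From HB Require Import structures.
From mathcomp Require Import all_boot all_order all_algebra.
From mathcomp Require Import reals.
From mathcomp Require Import mpoly zify.

Set Implicit Arguments.
Unset Strict Implicit.
Unset Printing Implicit Defensive.

Import Order.TTheory GRing.Theory Num.Theory.
Local Open Scope ring_scope.

(* Signs are booleans throughout: b : bool stands for (-1) ^+ b, so that       *)
(* cube n is {-1,1}^n and f : cube n -> bool is a function into {-1,1}.        *)
Definition cube (n : nat) : finType := {ffun 'I_n -> bool}.

(* As Num.sg 0 = 0, the equation forces p to be nonzero on the cube.           *)
Definition is_PTF (R : realType) (n d : nat) (f : cube n -> bool) : Prop :=
  exists2 p : {mpoly R[n]}, (msize p <= d.+1)%N &
    forall x : cube n, (-1) ^+ f x = Num.sg p.@[fun i => (-1) ^+ x i].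

Definition adjacent (n : nat) (x y : cube n) : bool :=
  #|[set i : 'I_n | x i != y i]| == 1%N.

Definition dichromatic_count (n : nat) (f : cube n -> bool) : nat :=
  #|[set e : {set cube n} | [exists x : cube n, exists y : cube n,
       [&& e == [set x; y], adjacent x y & f x != f y]]]|.

(* The k-th (from k = 0) integer closest to 0 of parity opposite to n:         *)
(* 0, 2, -2, 4, -4, ... for n odd and 1, -1, 3, -3, ... for n even. When the   *)
(* d closest integers are not unique (e.g. n odd, d = 2) the tie is thus       *)
(* broken towards the positive one; see dichromatic_count_mirror.              *)
Definition star_root (n k : nat) : int :=
  if odd k == odd n then k.+1%:Z else - k%:Z.

Definition pstar (n d : nat) : {poly int} :=
  \prod_(k < d) ('X - (star_root n k)%:P).

Definition coord_sum (n : nat) (x : cube n) : int := \sum_(i < n) (-1) ^+ x i.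

Definition sgn_sym (n : nat) (p : {poly int}) (x : cube n) : bool :=
  p.[coord_sum x] < 0.

Definition fstar (n d : nat) : cube n -> bool := sgn_sym (pstar n d).

Definition is_HSF (R : realType) (n d : nat) (f : cube n -> bool) : Prop :=
  is_PTF R d f /\ (dichromatic_count (@fstar n d) < dichromatic_count f)%N.

Lemma star_root_parity n k : odd `|star_root n k| = ~~ odd n.
Proof.
by rewrite /star_root; case: eqP => [<-|] //=; rewrite ?abszN /=;
  case: (odd k); case: (odd n).
Qed.

Lemma star_root_inj n : injective (star_root n).
Proof. by move=> j k; rewrite /star_root; do 2![case: eqP]; lia. Qed.

Lemma star_root_closest n d (z : int) :
    odd `|z| = ~~ odd n -> (forall k, (k < d)%N -> z != star_root n k) ->
  forall k, (k < d)%N -> (`|star_root n k| <= `|z|)%N.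
Proof.
move=> zn zN k kd; rewrite leqNgt; apply/negP => ltz.
have kle : (`|star_root n k| <= k.+1)%N by rewrite /star_root; case: ifP; lia.
have [z0|z0] := ltP 0 z.
  have /eqP[] := zN `|z|.-1 ltac:(lia).
  by rewrite /star_root; case: eqP; lia.
have ez : z = - `|z|%:Z by lia.
have /eqP[] := zN `|z|%N ltac:(lia).
by rewrite /star_root zn; case: (odd n) => /=; lia.
Qed.

Lemma coord_sum_parity n (x : cube n) : odd `|coord_sum x| = odd n.
Proof.
rewrite /coord_sum.
have -> : \sum_(i < n) (-1) ^+ x i = n%:Z - (\sum_(i < n) x i).*2%:Z :> int.
  have -> : n%:Z = \sum_(i < n) 1 by rewrite sumr_const card_ord natz.
  rewrite -muln2 big_distrl /= -natz natr_sum -sumrB.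
  by apply: eq_bigr => i _; case: (x i).
lia.
Qed.

Lemma fstar_sgn n d (x : cube n) :
  (-1) ^+ fstar d x = Num.sg (pstar n d).[coord_sum x].
Proof.
rewrite /fstar /sgn_sym sgr_def; case: eqP => [|_]; last by rewrite mulr1n.
rewrite horner_prod => /eqP/prodf_eq0[k _].
rewrite hornerXsubC subr_eq0 => /eqP eqk.
by have := star_root_parity n k; rewrite -eqk coord_sum_parity; case: odd.
Qed.

Lemma dichromatic_count_le n (f g : cube n -> bool) (h : cube n -> cube n) b :
    injective h -> (forall x y, adjacent (h x) (h y) = adjacent x y) ->
    (forall x, g (h x) = b (+) f x) ->
  (dichromatic_count f <= dichromatic_count g)%N.
Proof.
move=> hI hA hfg.
rewrite /dichromatic_count -(card_imset _ (imset_inj hI)).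
apply/subset_leq_card/subsetP => e' /imsetP[e].
rewrite inE => /existsP[x /existsP[y /and3P[/eqP-> xy fxy]]] {e'}->.
rewrite inE; apply/existsP; exists (h x); apply/existsP; exists (h y).
rewrite imsetU !imset_set1 eqxx hA xy !hfg /=.
by move: fxy; case: (b); case: (f x); case: (f y).
Qed.

(* Replacing the roots of pstar by their opposites, i.e. breaking the tie the  *)
(* other way, does not change the dichromatic count.                           *)
Lemma dichromatic_count_mirror n d :
  dichromatic_count (sgn_sym (n := n) (\prod_(k < d) ('X + (star_root n k)%:P)))
  = dichromatic_count (@fstar n d).
Proof.
pose h (x : cube n) : cube n := [ffun i => ~~ x i].
have hK : involutive h by move=> x; apply/ffunP => i; rewrite !ffunE negbK.
have hI := inv_inj hK.
have hA x y : adjacent (h x) (h y) = adjacent x y.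
  congr (_ == _); apply: eq_card => i; rewrite !inE !ffunE.
  by case: (x i); case: (y i).
have hS x : coord_sum (h x) = - coord_sum x.
  rewrite /coord_sum -sumrN; apply: eq_bigr => i _.
  by rewrite ffunE; case: (x i).
have main x : sgn_sym (\prod_(k < d) ('X + (star_root n k)%:P)) (h x)
              = odd d (+) fstar d x.
  have E : (\prod_(k < d) ('X + (star_root n k)%:P)).[coord_sum (h x)]
           = (-1) ^+ d * (pstar n d).[coord_sum x].
    rewrite !horner_prod hS -[d in _ ^+ d]card_ord -prodrN.
    by apply: eq_bigr => k _; rewrite !hornerE opprB addrC.
  have := fstar_sgn d x; rewrite /fstar /sgn_sym E -(signr_odd _ d).
  case: (odd d); rewrite ?expr1 ?expr0 ?mulN1r ?mul1r /= ?oppr_lt0;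
    by case: (ltrgt0P (pstar n d).[coord_sum x]) => // ->; rewrite sgr0.
apply/eqP; rewrite eqn_leq; apply/andP; split; last first.
  exact: dichromatic_count_le hI hA main.
apply: (dichromatic_count_le (b := odd d) hI hA) => x.
by rewrite -[X in _ (+) sgn_sym _ X]hK main addKb.
Qed.

(* Main.v *)
Require Import Defs.
From mathcomp Require Import all_boot all_order all_algebra.
From mathcomp Require Import reals.
From mathcomp Require Import mpoly zify ring lra.
Local Open Scope ring_scope.

Set Implicit Arguments.
Unset Strict Implicit.
Unset Printing Implicit Defensive.

Import Order.TTheory GRing.Theory Num.Theory.

(** Write n = 2m+3. The function f*_{n,2} is negative exactly on one middle
    layer, each of whose points is isolated, so D[f*] = n 'C(n, m+1). Single
    out two coordinates i and j, and let t be the sum of the 2m+1 others. The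
    sign [tilt] of a quadratic in t, x_i, x_j is negative exactly for t = -1
    when x_i = x_j = 1, for t = 1 when x_i <> x_j, and for t = 1 or -1 when
    x_i = x_j = -1. Summing over the negative points their numbers of positive
    neighbours gives at least (8m+9) 'C(2m+1, m), which is
    1 + m / (2 n^2) times D[f*]. *)

(** * Directed count of dichromatic edges *)

Definition flip n (x : cube n) (i : 'I_n) : cube n :=
  [ffun j => x j (+) (j == i)].

Lemma flipK n (i : 'I_n) : involutive (fun x : cube n => flip x i).
Proof. by move=> x; apply/ffunP => j; rewrite !ffunE addbK. Qed.

Lemma flip_inj n (x : cube n) : injective (flip x).
Proof.
by move=> i j /ffunP/(_ i); rewrite !ffunE eqxx => /addbI/esym/eqP.
Qed.

Lemma adjacentP n (x y : cube n) :
  reflect (exists i, y = flip x i) (adjacent x y).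
Proof.
apply: (iffP cards1P) => -[i].
  move=> /setP E; exists i; apply/ffunP => j; have := E j.
  by rewrite !inE ffunE => <-; case: (x j); case: (y j).
move=> ->; exists i; apply/setP => j.
by rewrite !inE ffunE; case: (x j); case: (j == i).
Qed.

(** A dichromatic edge has exactly one endpoint where [f] is true, so listing it from that endpoint,
    with the flipped coordinate, counts it once. *)
Lemma dichromatic_count_directed n (f : cube n -> bool) :
  dichromatic_count f
  = \sum_(x | f x) #|[set i | ~~ f (flip x i)]|.
Proof.
pose A := [set e : cube n * 'I_n | f e.1 && ~~ f (flip e.1 e.2)].
transitivity #|A|.
  pose h (e : cube n * 'I_n) : {set cube n} := [set e.1; flip e.1 e.2].
  have hI : {in A &, injective h}.
    move=> [x i] [y j]; rewrite !inE /= => /andP[fx fxi] /andP[fy fyj] E.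
    have xy : x = y.
      have : x \in h (y, j) by rewrite -E !inE eqxx.
      by rewrite !inE /= => /orP[/eqP|/eqP xE] //; rewrite -xE fx in fyj.
    subst y; have : flip x i \in h (x, j) by rewrite -E !inE eqxx orbT.
    rewrite !inE /= => /orP[/eqP xE|/eqP/flip_inj->] //.
    by rewrite xE fx in fxi.
  rewrite -(card_in_imset hI); apply: eq_card => e; rewrite inE.
  apply/existsP/imsetP => [[x /existsP[y /and3P[/eqP-> /adjacentP[i ->]]]]|].
    case fx: (f x) => fxi.
      by exists (x, i) => //; rewrite inE /= fx; case: (f _) fxi.
    (* Here [f x] is false, so the edge is read from its other end. *)
    exists (flip x i, i); last by rewrite /h /= flipK setUC.
    by rewrite inE /= flipK fx; case: (f _) fxi.
  case=> -[x i]; rewrite inE /= => /andP[fx fxi] ->.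
  exists x; apply/existsP; exists (flip x i); rewrite eqxx fx fxi /= andbT.
  by apply/adjacentP; exists i.
rewrite -sum1_card.
under [RHS]eq_bigr do rewrite -sum1_card.
by rewrite pair_big_dep; apply: eq_bigl => -[x i]; rewrite !inE.
Qed.

(** * Hamming weight and an upper bound for the count of [fstar] *)

Definition weight n (x : cube n) : nat := #|[set i | x i]|.

(** The ring is arbitrary because the identity serves over the integers for [fstar] and over the
    reals for the polynomial of [tilt]. *)
Lemma coord_sum_weight (R : pzRingType) n (x : cube n) :
  \sum_(i < n) (-1) ^+ x i = n%:R - (weight x).*2%:R :> R.
Proof.
rewrite /weight -sum1_card [in RHS]big_mkcond /= -muln2 big_distrl /= natr_sum.
have -> : n%:R = \sum_(i < n) 1 :> R by rewrite sumr_const card_ord.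
rewrite -sumrB; apply: eq_bigr => i _; rewrite inE.
by case: (x i); rewrite ?subr0 // expr1 -[(1 * 2)%N%:R]/(1 + 1 : R) opprD addNKr.
Qed.

Lemma weight_flip n (x : cube n) i :
  weight (flip x i) = if x i then (weight x).-1 else (weight x).+1.
Proof.
rewrite /weight; case xi: (x i).
  have -> : [set j | flip x i j] = [set j | x j] :\ i.
    apply/setP => j; rewrite !inE ffunE.
    by case: eqP => [->|]; rewrite ?xi ?addbF.
  by rewrite (cardsD1 i [set j | x j]) inE xi.
have -> : [set j | flip x i j] = i |: [set j | x j].
  apply/setP => j; rewrite !inE ffunE.
  by case: eqP => [->|]; rewrite ?xi ?addbF.
by rewrite cardsU1 inE xi.
Qed.

Lemma card_weight_le n k :
  (#|[set x : cube n | weight x == k]| <= 'C(n, k))%N.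
Proof.
pose h (x : cube n) : {set 'I_n} := [set i | x i].
have hI : injective h.
  by move=> x y /setP E; apply/ffunP => i; have := E i; rewrite !inE.
rewrite -[n in 'C(n, _)]card_ord -(card_draws _ k) -(card_imset _ hI).
apply/subset_leq_card/subsetP => _ /imsetP[x xk ->].
by move: xk; rewrite !inE.
Qed.

Lemma dichromatic_count_fstar2_le m :
  (dichromatic_count (@fstar m.*2.+3 2) <= m.*2.+3 * 'C(m.*2.+3, m.+1))%N.
Proof.
rewrite dichromatic_count_directed.
have fw (x : cube m.*2.+3) : fstar 2 x -> weight x == m.+1.
  rewrite /fstar /sgn_sym /pstar !big_ord_recl big_ord0 mulr1.
  rewrite /star_root /= odd_double /= /coord_sum coord_sum_weight.
  rewrite !hornerE /= -[(bump 0 0).+1]/2%N !natz.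
  move: (weight x) => w; set s := _ - _ => s_lt0.
  (* The two roots are 0 and 2, and 1 is the only integer strictly between them. *)
  have : s = 1 by nia.
  rewrite /s; lia.
apply: leq_trans (_ : \sum_(x : cube m.*2.+3 | weight x == m.+1) m.*2.+3 <= _)%N.
  rewrite [X in (X <= _)%N]big_mkcond [X in (_ <= X)%N]big_mkcond /=.
  apply: leq_sum => x _.
  case: ifP => // /fw ->; by rewrite -[X in (_ <= X)%N]card_ord max_card.
by rewrite sum_nat_const mulnC leq_mul2l -cardsE card_weight_le orbT.
Qed.

(** * Lower bound for the count of [tilt] *)

Lemma card_weight_slice n (i j : 'I_n) (a b : bool) k : i != j ->
  ('C(n - 2, k) <=
   #|[set x : cube n | [&& x i == a, x j == b & weight x == a + b + k]]|)%N.
Proof.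
move=> ij.
pose B := ~: [set i; j].
have cB : #|B| = (n - 2)%N by rewrite cardsCs setCK cards2 ij card_ord.
(* [h] injects the [k]-subsets of the complement of [{i, j}] into the slice. *)
pose h (A : {set 'I_n}) : cube n :=
  [ffun l => if l == i then a else if l == j then b else l \in A].
rewrite -cB -cards_draws.
have hI : {in [set A : {set 'I_n} | A \subset B & #|A| == k] &, injective h}.
  move=> A A'; rewrite !inE => /andP[/subsetP AB _] /andP[/subsetP A'B _].
  move=> /ffunP E; apply/setP => l; have := E l; rewrite !ffunE.
  have : (l \in A) ==> (l \in B) by apply/implyP/AB.
  have : (l \in A') ==> (l \in B) by apply/implyP/A'B.
  rewrite !inE negb_or.
  by case: (l == i); case: (l == j); case: (l \in A); case: (l \in A').
rewrite -(card_in_imset hI); apply/subset_leq_card/subsetP => x /imsetP[A].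
rewrite !inE => /andP[/subsetP AB /eqP cA] {x}->.
rewrite !ffunE !eqxx (eq_sym j) (negPf ij) !eqxx /=; apply/eqP.
have iA : i \notin A by apply/negP => /AB; rewrite !inE eqxx.
have jA : j \notin A by apply/negP => /AB; rewrite !inE eqxx orbT.
rewrite /weight (cardsD1 i) (cardsD1 j) !inE !ffunE (eq_sym j) (negPf ij) !eqxx.
rewrite addnA -cA /=; congr (_ + _)%N; apply: eq_card => l; rewrite !inE ffunE.
case: (eqVneq l i) => [->|li]; first by rewrite andbF (negPf iA).
by case: (eqVneq l j) => [->|lj] //=; rewrite (negPf jA).
Qed.

(* Since true stands for -1, t = 2m+1 - 2u where u is the weight off {i, j}. *)
Definition tilt m (i j : 'I_m.*2.+3) (x : cube m.*2.+3) : bool :=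
  if x i && x j then (weight x == m.+2) || (weight x == m.+3)
  else weight x == m.+1.

Section TiltCount.
Variables (m : nat) (i j : 'I_m.*2.+3).
Hypothesis ij : i != j.

Let fn (x : cube m.*2.+3) := #|[set l | ~~ tilt i j (flip x l)]|.

(** One flip cannot make both [i] and [j] true, so [tilt] still tests for weight [m.+1], which every
    flip destroys. *)
Lemma tilt_nbrs_none (x : cube m.*2.+3) :
  x i = false -> x j = false -> weight x = m.+1 -> fn x = m.*2.+3.
Proof.
move=> xi xj xw; rewrite /fn -[RHS]card_ord -cardsT; apply: eq_card => l.
rewrite !inE /tilt weight_flip !ffunE xi xj xw /=.
case: (eqVneq i l) => [<-|_]; rewrite ?xi //= ?(eq_sym j) ?(negPf ij) /=.
  lia.
by case: (x l); lia.
Qed.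

Lemma tilt_nbrs_one (x : cube m.*2.+3) :
  x i (+) x j -> weight x = m.+1 -> (m.*2.+2 <= fn x)%N.
Proof.
(* Only flipping [l0], the false one of [i] and [j], reaches the both-true case, where weight [m.+2]
   is negative. *)
move=> xij xw; pose l0 := if x i then j else i.
have -> : m.*2.+2 = #|[set~ l0]| by rewrite cardsC1 card_ord.
apply/subset_leq_card/subsetP => l; rewrite !inE /tilt weight_flip !ffunE xw.
rewrite /l0 !(eq_sym _ l); move: xij ij.
case xi: (x i) => /=; case xj: (x j) => //= _ _ /negPf -> /=;
  rewrite ?andbF; case: (x l); lia.
Qed.

(** Flipping any of the [m] true coordinates off [{i, j}] keeps both true and drops the weight to
    [m.+1], a positive point. *)
Lemma tilt_nbrs_both_low (x : cube m.*2.+3) :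
  x i -> x j -> weight x = m.+2 -> (m <= fn x)%N.
Proof.
move=> xi xj xw.
have -> : m = #|[set l | x l] :\: [set i; j]|.
  rewrite cardsD -/(weight x) xw.
  have /setIidPr-> : [set i; j] \subset [set l | x l].
    by apply/subsetP => l; rewrite !inE => /orP[]/eqP->.
  by rewrite cards2 ij subn2.
apply/subset_leq_card/subsetP => l; rewrite !inE negb_or => /andP[/andP[li lj]].
move=> xl; rewrite /tilt weight_flip !ffunE xw xl xi xj.
by rewrite !(eq_sym _ l) (negPf li) (negPf lj) /=; lia.
Qed.

(** Flipping [i] or [j] leaves weight [m.+2] without both true; flipping one of the [m] false
    coordinates gives weight [m.+4]. Both outcomes are positive. *)
Lemma tilt_nbrs_both_high (x : cube m.*2.+3) :
  x i -> x j -> weight x = m.+3 -> (m.+2 <= fn x)%N.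
Proof.
move=> xi xj xw.
have -> : m.+2 = #|[set i; j] :|: ~: [set l | x l]|.
  rewrite cardsU.
  have -> : [set i; j] :&: ~: [set l | x l] = set0.
    apply/setP => l; rewrite !inE; apply/negP => /andP[/orP[]/eqP->].
      by rewrite xi.
    by rewrite xj.
  rewrite cards0 cards2 ij cardsCs setCK card_ord -/(weight x) xw; lia.
apply/subset_leq_card/subsetP => l; rewrite !inE /tilt weight_flip !ffunE xw.
rewrite !(eq_sym _ l) xi xj.
case: (eqVneq l i) => [->|_] /=; first by rewrite xi; lia.
case: (eqVneq l j) => [->|_] /=; first by rewrite xj; lia.
by move=> /negPf ->; lia.
Qed.

Lemma dichromatic_count_tilt_ge :
  ((8 * m + 9) * 'C(m.*2.+1, m) <= dichromatic_count (tilt i j))%N.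
Proof.
pose S (a b : bool) k := [set x : cube m.*2.+3 |
  [&& x i == a, x j == b & weight x == a + b + k]]%N.
have cSm a b : ('C(m.*2.+1, m) <= #|S a b m|)%N.
  by have := card_weight_slice a b m ij; rewrite subn2.
have cSm1 a b : ('C(m.*2.+1, m) <= #|S a b m.+1|)%N.
  have := card_weight_slice a b m.+1 ij; rewrite subn2 /=.
  by rewrite -[X in (X <= _)%N -> _]bin_sub; last lia;
    have -> : (m.*2.+1 - m.+1 = m)%N by lia.
rewrite dichromatic_count_directed.
(* Each of the five slices has at least ['C(m.*2.+1, m)] points, and the coefficients add up to
   (2m+3) + 2(2m+2) + m + (m+2) = 8m+9. *)
pose g (x : cube m.*2.+3) : nat := ((x \in S false false m.+1) * m.*2.+3
  + (x \in S true false m) * m.*2.+2 + (x \in S false true m) * m.*2.+2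
  + (x \in S true true m) * m + (x \in S true true m.+1) * m.+2)%N.
have sS (A : {set cube m.*2.+3}) c :
    (\sum_x (x \in A) * c = #|A| * c)%N.
  by rewrite -big_distrl /= -sum1_card [in RHS]big_mkcond.
apply: leq_trans (_ : (\sum_x g x <= _)%N).
  rewrite !big_split /= !sS.
  have := cSm1 false false; have := cSm true false; have := cSm false true.
  have := cSm true true; have := cSm1 true true.
  move: #|_| #|_| #|_| #|_| #|_| 'C(_, _) => *; nia.
(* The slices are disjoint and consist of negative points, so at most one term of [g x] survives and
   the neighbour bounds apply pointwise. *)
rewrite [X in (_ <= X)%N]big_mkcond; apply: leq_sum => x _.
rewrite /g !inE /tilt -/(fn x).
case xi: (x i); case xj: (x j);
  rewrite ?eqxx /= ?mul0n ?addn0 ?add0n ?(add1n, add2n).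
- case: (eqVneq (weight x) m.+2) => [xw|_] /=.
    by rewrite xw ltn_eqF // addn0 mul1n tilt_nbrs_both_low.
  rewrite add0n; case: eqP => [xw|_] //=.
  by rewrite mul1n tilt_nbrs_both_high.
- by case: eqP => [xw|_] //; rewrite mul1n tilt_nbrs_one ?xi ?xj.
- by case: eqP => [xw|_] //; rewrite mul1n tilt_nbrs_one ?xi ?xj.
- by case: eqP => [xw|_] //; rewrite mul1n tilt_nbrs_none.
Qed.

End TiltCount.

(** * [tilt] as a quadratic threshold function *)

Lemma msizeM_leq (R : idomainType) n (p q : {mpoly R[n]}) a b :
  (msize p <= a.+1)%N -> (msize q <= b.+1)%N -> (msize (p * q) <= (a + b).+1)%N.
Proof.
have [->|p0] := eqVneq p 0; first by rewrite mul0r mmeasure0.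
have [->|q0] := eqVneq q 0; first by rewrite mulr0 mmeasure0.
by rewrite msizeM //; lia.
Qed.

Lemma msizeD_leq (R : nzRingType) n (p q : {mpoly R[n]}) k :
  (msize p <= k)%N -> (msize q <= k)%N -> (msize (p + q) <= k)%N.
Proof.
by move=> pk qk; apply: leq_trans (mmeasureD_le _ _ _) _; rewrite geq_max pk.
Qed.

Lemma tilt_PTF (R : realType) m (i j : 'I_m.*2.+3) : i != j ->
  is_PTF R 2 (tilt i j).
Proof.
move=> ij.
pose t : {mpoly R[m.*2.+3]} := \sum_l 'X_l - 'X_i - 'X_j.
(* At x_i + x_j = 2, 0, -2 this is 2t^2+t-2, 2t^2-t-2, 2t^2-3t-6. *)
pose p : {mpoly R[m.*2.+3]} :=
  t * (t *+ 2 + ('X_i + 'X_j - 1)) + ('X_i + 'X_j - 'X_i * 'X_j - 3%:MP).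
have sX l : (msize ('X_l : {mpoly R[m.*2.+3]}) <= 2)%N by rewrite msizeX mdeg1.
have sC (c : R) k : (msize (c%:MP : {mpoly R[m.*2.+3]}) <= k.+1)%N.
  by rewrite mmeasureC; case: (_ == _).
have st : (msize t <= 2)%N.
  rewrite /t; do 2![apply: msizeD_leq; last by rewrite mmeasureN].
  by apply: leq_trans (mmeasure_sum _ _ _ _) _; apply/bigmax_leqP.
have tE (x : cube m.*2.+3) : t.@[fun l => (-1) ^+ x l] =
    m.*2.+3%:R - (weight x).*2%:R - (-1) ^+ x i - (-1) ^+ x j.
  rewrite /t !mevalB !mevalXU raddf_sum /=.
  by under eq_bigr do rewrite mevalXU; rewrite coord_sum_weight.
clearbody t; exists p.
  rewrite /p; apply: msizeD_leq.
    apply: (@msizeM_leq _ _ _ _ 1 1) => //; apply: msizeD_leq.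
      by rewrite mulr2n; apply: msizeD_leq.
    by apply: msizeD_leq; [apply: msizeD_leq | rewrite mmeasureN; apply: sC].
  apply: msizeD_leq; last by rewrite mmeasureN; apply: sC.
  apply: msizeD_leq; last by rewrite mmeasureN (@msizeM_leq _ _ _ _ 1 1).
  by apply: leqW; apply: msizeD_leq.
move=> x.
rewrite /p !(mevalD, mevalN, mevalM, mevalMn, mevalXU, mevalC, meval1) tE.
rewrite /tilt; move: (x i) (x j) (weight x) => a b w.
have -> : m.*2.+3%:R = m%:R * 2 + 3 :> R by rewrite -muln2 -addn3 natrD natrM.
rewrite -muln2 natrM.
have sgE (c : bool) (y : R) : (if c then y < 0 else 0 < y) -> (-1) ^+ c = Num.sg y.
  by case: c => h; rewrite ?(ltr0_sg h) ?(gtr0_sg h).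
apply: sgE.
(* For weights up to [m] or from [m.+4] on, all three quadratics are positive, by the linear bound
   on [w] alone. The three weights in between are substituted one by one. *)
have [|[|[|[|]]]] : (w <= m)%N \/ w = m.+1 \/ w = m.+2 \/ w = m.+3 \/ (m.+4 <= w)%N.
- lia.
- move=> wm; have -> : (w == m.+1) = false by lia.
  have -> : (w == m.+2) = false by lia.
  have -> : (w == m.+3) = false by lia.
  have {wm} : w%:R <= m%:R :> R by rewrite ler_nat.
  by case: a; case: b => /=; nra.
- move=> ->; rewrite -(natr1 m) eqxx !ltn_eqF //.
  by case: a; case: b => /=; nra.
- move=> ->; rewrite -(natr1 m.+1) -(natr1 m) eqxx [m.+2 == m.+1]gtn_eqF //.
  by case: a; case: b => /=; nra.
- move=> ->; rewrite -(natr1 m.+2) -(natr1 m.+1) -(natr1 m) eqxx !gtn_eqF //.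
  by case: a; case: b => /=; nra.
move=> wm; have -> : (w == m.+1) = false by lia.
have -> : (w == m.+2) = false by lia.
have -> : (w == m.+3) = false by lia.
have {wm} : m%:R + 4 <= w%:R :> R by rewrite -natrD ler_nat addn4.
by case: a; case: b => /=; nra.
Qed.

(** * Comparison of the two counts *)

Lemma fstar2_count_tilt_bound m (i j : 'I_m.*2.+3) : i != j ->
  ((2 * m.*2.+3 ^ 2 + m) * dichromatic_count (@fstar m.*2.+3 2)
    <= 2 * m.*2.+3 ^ 2 * dichromatic_count (tilt i j))%N.
Proof.
move=> ij; have := dichromatic_count_fstar2_le m.
have := dichromatic_count_tilt_ge ij.
have := mul_bin_diag m.*2.+3 m; have := mul_bin_down m.*2.+2 m => /=.
have -> : (m.*2.+2 - m = m.+2)%N by lia.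
move: (dichromatic_count (tilt i j)) (dichromatic_count (@fstar _ 2)) => D D'.
move: 'C(m.*2.+1, m) 'C(m.*2.+2, m) 'C(m.*2.+3, m.+1) => C C2 C3 h1 h2 h3 h4.
(* The two binomial recurrences give (m+1)(m+2) C3 = (2m+3)(2m+2) C; the factor m+1 cancels. *)
have h5 : (m.+2 * C3 = 2 * m.*2.+3 * C)%N.
  by apply/eqP; rewrite -(eqn_pmul2l (ltn0Sn m)); apply/eqP; nia.
have -> : (2 * m.*2.+3 ^ 2 + m = (8 * m + 9) * m.+2)%N by nia.
apply: (@leq_trans (2 * m.*2.+3 ^ 2 * ((8 * m + 9) * C))%N); last first.
  by rewrite leq_mul2l h3 orbT.
rewrite [X in (_ <= X)%N]mulnCA -mulnA leq_mul2l; apply/orP; right.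
apply: (@leq_trans (m.+2 * (m.*2.+3 * C3))%N); first by rewrite leq_mul2l h4 orbT.
by rewrite mulnCA h5; nia.
Qed.

Theorem mainTheorem3 (R : realType) :
  exists2 c : R, 0 < c &
    forall n : nat, odd n -> (5 <= n)%N ->
      exists f : cube n -> bool,
        is_HSF R 2 f /\
        (1 + c / n%:R) * (dichromatic_count (@fstar n 2))%:R
          <= (dichromatic_count f)%:R :> R.
Proof.
(* The gain m / (2 n^2) is at least 1 / (10 n) exactly when n <= 5m; with n = 2m+3 this means m >=
   1, that is n >= 5, with equality at n = 5. *)
exists 10^-1; first by rewrite invr_gt0.
move=> n n_odd n5; have [m nE] : exists m, n = m.*2.+3 by exists (n./2.-1); lia.
subst n; have m1 : (0 < m)%N by lia.
pose i : 'I_m.*2.+3 := ord0; pose j : 'I_m.*2.+3 := ord_max.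
have ij : i != j by [].
exists (tilt i j); have := fstar2_count_tilt_bound ij.
have C_gt0 : (0 < 'C(m.*2.+1, m))%N by rewrite bin_gt0; lia.
have := dichromatic_count_tilt_ge ij.
have fP := tilt_PTF R ij; rewrite /is_HSF.
move: (dichromatic_count (tilt i j)) (dichromatic_count (@fstar _ 2)).
move=> D D' D0 DD'.
have D_gt0 : (0 < D)%N by apply: (leq_trans _ D0); rewrite muln_gt0 C_gt0; lia.
split; first split=> //.
  rewrite ltnNge; apply/negP => leDD'.
  (* If D <= D', then (2n^2+m) D <= (2n^2+m) D' <= 2n^2 D, which forces m D = 0. *)
  have : (m * D <= 0)%N.
    rewrite -(leq_add2l (2 * m.*2.+3 ^ 2 * D)%N) addn0 -mulnDl.
    by apply: (leq_trans _ DD'); rewrite leq_mul2l leDD' orbT.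
  by rewrite leqNgt muln_gt0 m1 D_gt0.
have {DD'} : (2 * m.*2.+3%:R ^+ 2 + m%:R) * D'%:R <= 2 * m.*2.+3%:R ^+ 2 * D%:R :> R.
  by rewrite -natrX -!natrM -natrD -natrM ler_nat.
have : m.*2.+3%:R <= 5 * m%:R :> R by rewrite -natrM ler_nat; lia.
have : 0 < m.*2.+3%:R :> R by rewrite ltr0n.
move: (m.*2.+3%:R) => N N0 Nm h.
have -> : 1 + 10^-1 / N = (10 * N + 1) / (10 * N) by field; rewrite gt_eqF.
rewrite mulrAC ler_pdivrMr ?mulr_gt0 //.
have D'0 : 0 <= D'%:R :> R by rewrite ler0n.
(* After scaling by 5N the claim is 25 times [h], combined with 5N <= 25m. *)
have : 5 * N * ((10 * N + 1) * D'%:R) <= 5 * N * (D%:R * (10 * N)).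
  by nra.
by rewrite ler_pM2l ?mulr_gt0.
Qed.
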